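(* For any partition $\rho$ (written $\rho=(\rho_1,\dots,\rho_{\ell(\rho)})$) and any positive integers $k,m$, one has $$a^{k}_{\rho \cup (m)} = \delta_{m,1}\, a^k_{\rho} +\sum_{1 \leq i \leq \ell(\rho)} \rho_i\, a^{k-1}_{\rho \setminus (\rho_{i}) \cup (\rho_{i}+m)} + \sum_{\substack{r+s=m \\ r,s \geq 1}} a^{k-1}_{\rho \cup (r,s)},$$ where the last sum runs over ordered pairs $(r,s)$ of positive integers with $r+s=m$.
   Context: A partition $\lambda$ of $n\ge 0$ (written $\lambda\vdash n$) is a non-increasing finite sequence of positive integers (parts) with sum $n=|\lambda|$; $\ell(\lambda)$ is its number of parts. $\lambda\setminus(i)$ is the partition obtained by erasing one part equal to $i$, and $\lambda\cup(i)$, $\lambda\cup(i,j)$ are obtained by adding a part $i$, respectively parts $i$ and $j$ (and reordering). $\delta_{m,1}$ is the Kronecker delta. In the group algebra $\mathbb{Z}[S_n]$ of the symmetric group, the Jucys-Murphy elements are $J_i=\sum_{j<i}(j\ i)$ for $1\le i\le n$ (so $J_1=0$). They commute with each other, and any symmetric function evaluated in $J_1,\dots,J_n$ is central in $\mathbb{Z}[S_n]$. Let $\mathcal{C}_\lambda$ be the sum of all permutations in $S_n$ of cycle-type $\lambda$. Let $h_k$ denote the complete homogeneous symmetric function of degree $k$ ($h_0=1$). The integers $a^k_\lambda$ ($k\ge 0$, $\lambda$ a partition) are defined by $$h_k(J_1,\dots,J_n)=\sum_{\lambda\vdash n}a^k_\lambda\,\mathcal{C}_\lambda\qquad (n\ge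 0).$$ For $n=0$ (the trivial group, no variables), this means $a^k_\emptyset=\delta_{k,0}$. *)

(* Defs.v *)
From HB Require Import structures.
From mathcomp Require Import all_boot all_order all_fingroup all_algebra.
From mathcomp Require Import zify.

Set Implicit Arguments.
Unset Strict Implicit.
Unset Printing Implicit Defensive.

Import Order.TTheory GRing.Theory Num.Theory.
Local Open Scope ring_scope.

Definition is_intpart (l : seq nat) : bool := sorted geq l && (0%N \notin l).

Record intpart := IntPart { parts :> seq nat; _ : is_intpart parts }.

HB.instance Definition _ := [isSub for parts].
HB.instance Definition _ := [Choice of intpart by <:].

Fact mkpart_subproof (s : seq nat) :
  is_intpart (sort geq [seq i <- s | (0 < i)%N]).
Proof.
by rewrite /is_intpart sort_sorted 1?mem_sort ?mem_filter // => x y; apply: leq_total.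
Qed.

(* Zero entries of [s] are dropped. *)
Definition mkpart (s : seq nat) : intpart := IntPart (mkpart_subproof s).

(* Sequences of length [n] with entries in {0..n} and sum [n] reach every
   partition of [n], by padding it with zeros. *)
Definition partitions (n : nat) : seq intpart :=
  undup [seq mkpart (map val t) | t : n.-tuple 'I_n.+1 <- enum {: n.-tuple 'I_n.+1}
                                & sumn (map val t) == n].

(* The group algebra Z[G]. It is a new type rather than a synonym of
   {ffun gT -> int}, whose canonical product is pointwise. *)
Record galg (gT : finGroupType) := GAlg { gcoef : {ffun gT -> int} }.

Section GroupAlgebra.
Variable gT : finGroupType.
Local Notation A := (galg gT).
Implicit Types f g h : A.

HB.instance Definition _ := [isNew for @gcoef gT].
HB.instance Definition _ := [Choice of A by <:].

Definition gzero : A := GAlg 0.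
Definition gopp f : A := GAlg (- gcoef f).
Definition gadd f g : A := GAlg (gcoef f + gcoef g).
Definition gone : A := GAlg [ffun x => (x == 1%g)%:R].
Definition gmul f g : A :=
  GAlg [ffun x => \sum_(y : gT) gcoef f y * gcoef g (y^-1 * x)%g].

Fact gaddA : associative gadd.
Proof. by move=> f g h; apply: val_inj; apply: addrA. Qed.
Fact gaddC : commutative gadd.
Proof. by move=> f g; apply: val_inj; apply: addrC. Qed.
Fact gadd0 : left_id gzero gadd.
Proof. by move=> f; apply: val_inj; apply: add0r. Qed.
Fact gaddN : left_inverse gzero gopp gadd.
Proof. by move=> f; apply: val_inj; apply: addNr. Qed.

HB.instance Definition _ :=
  GRing.isZmodule.Build A gaddA gaddC gadd0 gaddN.

Fact gmulA : associative gmul.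
Proof.
move=> f g h; apply: val_inj; apply/ffunP=> x; rewrite !ffunE /=.
under eq_bigr => y _ do rewrite ffunE mulr_sumr.
under [RHS]eq_bigr => z _ do rewrite ffunE mulr_suml.
rewrite [RHS]exchange_big /=; apply: eq_bigr => y _.
rewrite [RHS](reindex_inj (mulgI y)) /=; apply: eq_bigr => z _.
by rewrite mulKg invMg !mulgA mulrA.
Qed.

Fact gmul1l : left_id gone gmul.
Proof.
move=> f; apply: val_inj; apply/ffunP=> x; rewrite !ffunE /=.
rewrite (bigD1 1%g) //= ffunE eqxx mul1r invg1 mul1g big1 ?addr0 //.
by move=> y /negPf y1; rewrite ffunE y1 mul0r.
Qed.

Fact gmul1r : right_id gone gmul.
Proof.
move=> f; apply: val_inj; apply/ffunP=> x; rewrite !ffunE /=.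
rewrite (bigD1 x) //= ffunE mulVg eqxx mulr1 big1 ?addr0 //.
move=> y yx; rewrite ffunE -eq_mulVg1 (negPf yx) mulr0 //.
Qed.

Fact gmulDl : left_distributive gmul gadd.
Proof.
move=> f g h; apply: val_inj; apply/ffunP=> x; rewrite !ffunE /= -big_split /=.
by apply: eq_bigr => y _; rewrite ffunE mulrDl.
Qed.

Fact gmulDr : right_distributive gmul gadd.
Proof.
move=> f g h; apply: val_inj; apply/ffunP=> x; rewrite !ffunE /= -big_split /=.
by apply: eq_bigr => y _; rewrite ffunE mulrDr.
Qed.

Fact gone_neq0 : gone != 0.
Proof.
apply/eqP => /(congr1 val)/ffunP/(_ 1%g).
by rewrite !ffunE eqxx.
Qed.

HB.instance Definition _ :=
  GRing.Zmodule_isNzRing.Build A gmulA gmul1l gmul1r gmulDl gmulDr gone_neq0.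

Definition gbase (x : gT) : A := GAlg [ffun y => (y == x)%:R].

End GroupAlgebra.

(* The sum over weakly increasing index sequences; the factors of each monomial
   are multiplied in increasing order, so [R] need not be commutative. *)
Definition hsym (R : pzRingType) (n k : nat) (x : 'I_n -> R) : R :=
  \sum_(t : k.-tuple 'I_n | sorted leq (map val t)) \prod_(i <- t) x i.

(* Indices are shifted by one: [@JM n i] is the element J_(i+1).
   Permutations are multiplied by (s * t) x = t (s x); as x |-> x^-1 fixes
   transpositions and class sums, the opposite convention gives the same
   integers a^k_lambda. *)
Definition JM (n : nat) (i : 'I_n) : galg {perm 'I_n} :=
  \sum_(j < n | (j < i)%N) gbase (tperm j i).

Definition cycle_type (n : nat) (s : {perm 'I_n}) : intpart :=
  mkpart [seq #|pred_of_set c| | c in porbits s].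

Definition class_sum (n : nat) (l : intpart) : galg {perm 'I_n} :=
  \sum_(s : {perm 'I_n} | cycle_type s == l) gbase s.

(* The defining property of the family a^k_lambda; such a family exists by
   [JM_complete_coeffs_exist] below. *)
Definition JM_complete_coeffs (a : nat -> intpart -> int) : Prop :=
  forall n k : nat,
    hsym k (@JM n) = \sum_(l <- partitions n) class_sum n l *~ a k l.

Section GroupAlgebraTheory.
Variable gT : finGroupType.
Implicit Types (x y : gT) (h : galg gT).

Lemma gcoef_sum (I : Type) (r : seq I) (P : pred I) (F : I -> galg gT) x :
  gcoef (\sum_(i <- r | P i) F i) x = \sum_(i <- r | P i) gcoef (F i) x.
Proof. by elim/big_rec2: _ => [|i _ y _ <-]; rewrite ffunE. Qed.

Lemma gcoef_mulz h (z : int) x : gcoef (h *~ z) x = gcoef h x * z.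
Proof.
have gN h' : gcoef (- h') x = - gcoef h' x by rewrite ffunE.
have gn n : gcoef (h *+ n) x = gcoef h x * n%:R.
  elim: n => [|n IHn]; first by rewrite !mulr0 ffunE.
  by rewrite mulrS ffunE IHn -natr1 mulrDr mulr1 addrC.
case: z => n; first by rewrite -pmulrn gn natz.
by rewrite NegzE mulrNz gN -pmulrn gn natz mulrN.
Qed.

Lemma gcoef_baseM x h y : gcoef (gbase x * h) y = gcoef h (x^-1 * y)%g.
Proof.
rewrite ffunE (bigD1 x) //= ffunE eqxx mul1r big1 ?addr0 //.
by move=> z /negPf zx; rewrite ffunE zx mul0r.
Qed.

Lemma gcoef_Mbase x h y : gcoef (h * gbase x) y = gcoef h (y * x^-1)%g.
Proof.
rewrite ffunE (bigD1 (y * x^-1)%g) //= ffunE invMg invgK mulgKV eqxx mulr1.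
rewrite big1 ?addr0 // => z zx; rewrite ffunE.
case: eqP => [e|]; last by rewrite mulr0.
by move: zx; rewrite -e invMg invgK mulKVg eqxx.
Qed.

Lemma gbaseM x y : gbase x * gbase y = gbase (x * y)%g.
Proof.
apply: val_inj; apply/ffunP => z; rewrite -[val]/(@gcoef _) gcoef_baseM !ffunE.
by rewrite (can2_eq (mulKVg x) (mulKg x)).
Qed.

Lemma gbase1 : gbase (1%g : gT) = 1.
Proof. by apply: val_inj; apply/ffunP => z; rewrite !ffunE. Qed.

Lemma comm_gcoefJ h y x :
  GRing.comm h (gbase y) -> gcoef h (x ^ y)%g = gcoef h x.
Proof.
move=> hc; have /(congr1 (fun f : galg gT => gcoef f (x * y)%g)) := hc.
by rewrite gcoef_baseM gcoef_Mbase mulgK.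
Qed.

End GroupAlgebraTheory.

(* The recursion of complete symmetric functions on the number of variables. *)
Fixpoint hrec (R : pzRingType) (x : nat -> R) (i : nat) : nat -> R :=
  match i with
  | 0 => fun k => (k == 0%N)%:R
  | i'.+1 => fix aux k := match k with
                          | 0 => 1
                          | k'.+1 => hrec x i' k'.+1 + aux k' * x i'
                          end
  end.

Section HrecTheory.
Variables (R : pzRingType) (x : nat -> R).
Local Notation H := (hrec x).

Lemma hrecS0 i : H i 0 = 1.
Proof. by case: i. Qed.

Lemma hrecSS i k : H i.+1 k.+1 = H i k.+1 + H i.+1 k * x i.
Proof. by []. Qed.

Lemma hsym_hrec (n k : nat) : hsym k (fun i : 'I_n => x i) = H n k.
Proof.
pose P i (s : seq 'I_n) :=
  pairwise leq (map val s) && all (fun j : 'I_n => j < i)%N s.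
pose S i k := \sum_(t : k.-tuple 'I_n | P i t) \prod_(j <- t) x (val j).
suff SE i : (i <= n)%N -> forall k, S i k = H i k.
  rewrite -SE //; apply: eq_bigl => t; rewrite (sorted_pairwise leq_trans).
  by rewrite /P [X in _ && X](_ : _ = true) ?andbT //; apply/allP => j _ /=.
have S0 i' : S i' 0 = 1.
  rewrite /S (big_pred1 [tuple]) ?big_nil // => t.
  by rewrite (tuple0 t) /= eqxx.
elim: i => [|i IHi] lt_in [|{}k]; rewrite ?S0 ?hrecS0 //.
  by rewrite /S big_pred0 // => t; case/tupleP: t => a t; rewrite /P /= andbF.
suff SS k' : S i.+1 k'.+1 = S i k'.+1 + S i.+1 k' * x i.
  elim: k => [|k IHk]; rewrite SS hrecSS IHi 1?ltnW ?IHk //.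
  by rewrite S0 hrecS0.
pose oi := Ordinal lt_in.
have PA (s : seq 'I_n) : (0 < size s)%N ->
    P i.+1 s && (last oi s != oi) = P i s.
  case/lastP: s => [|s l] //= _.
  rewrite /P map_rcons pairwise_rcons !all_rcons last_rcons all_map.
  apply/idP/idP => [/andP[/andP[/andP[le_l ->] /andP[lt_l _]] nl]|].
    have lt_li : (l < i)%N by move: nl lt_l; rewrite -val_eqE /= ltnS ltn_neqAle => -> ->.
    rewrite le_l lt_li /=; apply: sub_all le_l => j /= le_jl.
    exact: leq_ltn_trans le_jl lt_li.
  case/andP=> /andP[-> ->] /andP[lt_li lt_si]; rewrite -val_eqE /= ltnW //.
  rewrite (ltn_eqF lt_li) andbT /=; apply: sub_all lt_si => j /= ; exact: ltnW.
have PB (s : seq 'I_n) : P i.+1 (rcons s oi) = P i.+1 s.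
  rewrite /P map_rcons pairwise_rcons !all_rcons all_map /= ltnSn /=.
  rewrite andbAC; case: (pairwise _ _); rewrite ?andbF ?andbT //=.
  by rewrite [all _ s in X in X && _](_ : _ = all (fun j : 'I_n => j < i.+1)%N s) ?andbb.
rewrite {1}/S (bigID (fun t : k'.+1.-tuple 'I_n => last oi t != oi)) /=; congr (_ + _).
  by apply: eq_bigl => t; rewrite PA // size_tuple.
rewrite /S mulr_suml.
rewrite (reindex_onto (fun t : k'.-tuple 'I_n => [tuple of rcons t oi])
   (fun t => [tuple of belast (thead t) (behead t)])) /=; last first.
  move=> t /andP[_ /negPn/eqP lt]; apply: val_inj => /=.
  case/tupleP: t lt => a t /= lt.
  by rewrite theadE [RHS]lastI lt.
apply: eq_big => [t|t _]; last by rewrite /= -cats1 big_cat big_seq1.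
rewrite PB last_rcons eqxx andbT; case: (P _ _) => //=.
apply/eqP/val_inj => /=; rewrite /thead (tnth_nth oi) /= nth0.
by case: (val t) => //= a s; rewrite belast_rcons.
Qed.

End HrecTheory.

Lemma hrec_comm (R : pzRingType) (x : nat -> R) (y : R) (i k : nat) :
  (forall j, (j < i)%N -> GRing.comm y (x j)) -> GRing.comm y (hrec x i k).
Proof.
elim: i k => [|i IHi] k xy; first exact: commr_nat.
elim: k => [|k IHk]; first exact: commr1.
rewrite hrecSS; apply: commrD; first by apply: IHi => j /ltnW; apply: xy.
by apply: commrM => //; apply: xy.
Qed.

(* [s] plays the role of the adjacent transposition (i i+1). *)
Lemma hrec_comm_swap (R : pzRingType) (x : nat -> R) (s : R) (i k : nat) :
  s * s = 1 -> x i.+1 * s = s * x i + 1 -> GRing.comm (x i) (x i.+1) ->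
  (forall j, (j < i)%N -> GRing.comm s (x j)) ->
  GRing.comm s (hrec x i.+2 k).
Proof.
move=> ss ys xy sx.
have xs : x i * s = s * x i.+1 - 1.
  have : s * (x i.+1 * s) * s = s * (s * x i + 1) * s by rewrite ys.
  rewrite -mulrA -[X in _ * X]mulrA ss mulr1 mulrDr mulrA ss mul1r mulr1.
  by rewrite mulrDl ss => ->; rewrite addrK.
have cD : GRing.comm s (x i + x i.+1).
  by rewrite /GRing.comm mulrDl mulrDr ys xs addrC addrA addrAC addrNK addrC.
have cM : GRing.comm s (x i.+1 * x i).
  rewrite /GRing.comm -mulrA xs mulrBr mulr1 [x i.+1 * (s * _)]mulrA ys mulrDl mul1r addrK.
  by rewrite -mulrA xy.
have cH : GRing.comm s (hrec x i k) by apply: hrec_comm.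
have [n] := ubnP k; elim: n k cH => // n IHn [|[|k]] cH lt_kn.
- exact: commr1.
- by rewrite !hrecSS !hrecS0 !mul1r -addrA; apply: commrD => //; apply: hrec_comm.
have -> : hrec x i.+2 k.+2 = hrec x i k.+2 + hrec x i.+2 k.+1 * (x i + x i.+1)
                             - hrec x i.+2 k * (x i.+1 * x i).
  have e : hrec x i.+1 k.+1 = hrec x i.+2 k.+1 - hrec x i.+2 k * x i.+1.
    by rewrite [hrec x i.+2 k.+1]hrecSS addrK.
  rewrite [LHS]hrecSS [hrec x i.+1 _]hrecSS e mulrBl mulrDr -!mulrA.
  by rewrite -!addrA; congr (_ + (_ + _)); rewrite addrC.
have cI j : (j < n)%N -> GRing.comm s (hrec x i.+2 j).
  by move=> lt_jn; apply: IHn => //; apply: hrec_comm.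
apply: commrB; last by apply: commrM => //; apply: cI; lia.
by apply: commrD => //; apply: commrM => //; apply: cI.
Qed.

Section Central.
Variable n : nat.
Local Notation A := (galg {perm 'I_n}).

Definition JMn (i : nat) : A := oapp (@JM n) 0 (insub i).

Lemma JMnE (i : 'I_n) : JMn i = JM i.
Proof. by rewrite /JMn valK. Qed.

Lemma JM_mul_base (i : 'I_n) (s : {perm 'I_n}) :
  JM i * gbase s = gbase s * \sum_(j < n | (j < i)%N) gbase (tperm (s j) (s i)).
Proof.
rewrite /JM mulr_suml mulr_sumr; apply: eq_bigr => j _.
by rewrite !gbaseM -tpermJ conjgE !mulgA mulgV mul1g.
Qed.

Lemma JM_comm_base (i : 'I_n) (s : {perm 'I_n}) :
    s i = i -> (forall j : 'I_n, (s j < i)%N = (j < i)%N) ->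
  GRing.comm (gbase s) (JM i).
Proof.
move=> si ss; rewrite /GRing.comm JM_mul_base; congr (_ * _).
rewrite /JM (reindex_inj (@perm_inj _ s)) /=.
by apply: eq_big => [j|j _]; rewrite ?ss ?si.
Qed.

Lemma JMn_comm i j : GRing.comm (JMn i) (JMn j).
Proof.
wlog lt_ij : i j / (i < j)%N => [hw|].
  by case: (ltngtP i j) => [/hw // | /hw/commr_sym // | ->].
case: (ltnP j n) => lt_jn; last by rewrite /JMn [insub j]insubF ?ltnNge ?lt_jn //; apply: commr0.
rewrite -[i]/(val (Ordinal (ltn_trans lt_ij lt_jn))) -[j]/(val (Ordinal lt_jn)) !JMnE.
apply: commr_sym; apply: commr_sum => a /= lt_ai; apply: commr_sym.
apply: JM_comm_base => [|b]; first by rewrite tpermD // -val_eqE /=; apply/eqP; lia.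
by case: tpermP => // -> /=; rewrite ?lt_ij ?(ltn_trans lt_ai).
Qed.

Lemma hsym_JM k : hsym k (@JM n) = hrec JMn n k.
Proof.
rewrite -hsym_hrec; apply: eq_bigr => t _.
by apply: eq_bigr => i _; rewrite JMnE.
Qed.

Lemma hsym_JM_comm_adj k (i j : 'I_n) : val j = i.+1 ->
  GRing.comm (gbase (tperm i j)) (hsym k (@JM n)).
Proof.
move=> ji; rewrite hsym_JM; set s := gbase _.
have ltj : (i.+1 < n)%N by rewrite -ji; apply: ltn_ord.
have sl (l : nat) : l != i -> l != i.+1 -> GRing.comm s (JMn l).
  move=> li lj; rewrite /JMn; case: insubP => [a _ ea|_] /=; last exact: commr0.
  apply: JM_comm_base; first by rewrite tpermD // -val_eqE /= ?ji ea eq_sym.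
  by move=> b; case: tpermP => // ->; rewrite ?ji ea; move: li lj; lia.
suff: forall m, (i.+2 <= m)%N -> forall k, GRing.comm s (hrec JMn m k) by apply.
elim=> // m IHm; rewrite leq_eqVlt => /predU1P[[<-]|lt_im] {}k.
  apply: hrec_comm_swap.
  - by rewrite gbaseM tperm2 gbase1.
  - rewrite -ji !JMnE JM_mul_base -gbase1 -(tperm2 i j) -gbaseM -mulrDr.
    congr (_ * _); rewrite (bigD1 i) /= ?ji // addrC tpermL tpermR.
    rewrite [gbase (tperm j i)]/(gbase _) tpermC; congr (_ + _).
    rewrite /JM; apply: eq_big => [a|a /andP[lt_aj ai]].
      by rewrite -val_eqE /= ltnS; case: ltngtP.
    by rewrite tpermD // 1?eq_sym // -val_eqE /= ji; move: lt_aj; lia.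
  - exact: JMn_comm.
  - by move=> l lt_li; apply: sl; apply/eqP; lia.
elim: k => [|k IHk]; first exact: commr1.
rewrite hrecSS; apply: commrD; first exact: IHm.
by apply: commrM => //; apply: sl; apply/eqP; lia.
Qed.

Lemma hsym_JM_central k (s : {perm 'I_n}) :
  GRing.comm (gbase s) (hsym k (@JM n)).
Proof.
have cM (a b : {perm 'I_n}) : GRing.comm (gbase a) (hsym k (@JM n)) ->
    GRing.comm (gbase b) (hsym k (@JM n)) ->
    GRing.comm (gbase (a * b)%g) (hsym k (@JM n)).
  by move=> ca cb; rewrite -gbaseM; apply/commr_sym/commrM; apply/commr_sym.
have c1 : GRing.comm (gbase 1%g) (hsym k (@JM n)).
  by rewrite gbase1; apply/commr_sym/commr1.
have [ts -> _] := prod_tpermP s.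
elim: ts => [|[i j] ts IHts]; rewrite ?big_nil ?big_cons //.
apply: (cM) => //= {ts IHts}.
wlog lt_ij : i j / (i < j)%N => [hw|].
  case: (ltngtP i j) => [/hw // | /hw | /val_inj ->]; first by rewrite tpermC.
  by rewrite tperm1.
have [m] := ubnP (j - i)%N; elim: m j lt_ij => // m IHm j lt_ij le_m.
case: (eqVneq (val j) i.+1) => [ji | nji]; first exact: hsym_JM_comm_adj.
move/eqP: nji => /= nji; have lt_p : (j.-1 < n)%N by have := ltn_ord j; lia.
pose p := Ordinal lt_p.
have -> : tperm i j = (tperm p j * tperm i p * tperm p j)%g.
  rewrite -[X in (X * _ * _)%g]tpermV -mulgA -conjgE tpermJ tpermL tpermD //.
    by rewrite -val_eqE /=; apply/eqP; lia.
  by rewrite -val_eqE /=; apply/eqP; lia.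
have cp : GRing.comm (gbase (tperm p j)) (hsym k (@JM n)).
  by apply: hsym_JM_comm_adj => /=; lia.
apply: (cM) => //; apply: (cM) => //; apply: IHm => /=; lia.
Qed.

End Central.

Section Conjugacy.
Variable T : finType.
Implicit Types s t u : {perm T}.

Lemma porbit_imset s x : porbit s x \in porbits s.
Proof. exact: imset_f. Qed.

Lemma iter_porbit_mod s x i : iter (i %% #|porbit s x|) s x = iter i s x.
Proof.
rewrite {2}(divn_eq i #|porbit s x|) addnC iterD; congr (iter _ _ _).
elim: (i %/ _)%N => [|q IHq]; first by rewrite mul0n.
by rewrite mulSn iterD -IHq iter_porbit.
Qed.

Lemma iter_porbit_inj s x i j : (i < #|porbit s x|)%N -> (j < #|porbit s x|)%N ->
  iter i s x = iter j s x -> i = j.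
Proof.
move=> lti ltj e; apply/eqP.
rewrite -(nth_uniq x _ _ (uniq_traject_porbit s x)) ?size_traject //.
by rewrite !nth_traject // e.
Qed.

Lemma perm_conj_porbits s t :
  perm_eq [seq #|pred_of_set c| | c in porbits s]
          [seq #|pred_of_set c| | c in porbits t] ->
  exists u, t = (s ^ u)%g.
Proof.
have [x0 _|T0] := pickP (fun _ : T => true); last first.
  by exists s; apply/permP => x; have := T0 x.
rewrite /image_mem; set E1 := enum (porbits s); set E2 := enum (porbits t).
case/(perm_iotaP 0%N) => Is pIs eIs.
pose E3 := [seq nth set0 E2 i | i <- Is].
have pE3 : perm_eq E3 E2.
  by apply/(perm_iotaP set0); exists Is; rewrite // -(size_map (fun c => #|pred_of_set c|)).
have eE : [seq #|pred_of_set c| | c <- E1] = [seq #|pred_of_set c| | c <- E3].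
  rewrite eIs /E3 -map_comp; apply/eq_in_map => i /=.
  by rewrite (perm_mem pIs) mem_iota size_map => lti; rewrite (nth_map set0).
have sE : size E1 = size E3 by rewrite -(size_map (fun c => #|pred_of_set c|)) eE size_map.
have uE3 : uniq E3 by rewrite (perm_uniq pE3) enum_uniq.
have mE1 x : porbit s x \in E1 by rewrite mem_enum porbit_imset.
pose f c := nth set0 E3 (index c E1).
have fP x : f (porbit s x) \in porbits t.
  by rewrite -mem_enum -(perm_mem pE3) mem_nth // -sE index_mem.
have fcard x : #|f (porbit s x)| = #|porbit s x|.
  have := congr1 (fun l => nth 0%N l (index (porbit s x) E1)) eE.
  rewrite !(nth_map set0) -?sE ?index_mem ?mE1 //.
  by rewrite nth_index // => ->.
have finj x y : f (porbit s x) = f (porbit s y) -> porbit s x = porbit s y.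
  move/eqP; rewrite nth_uniq -?sE ?index_mem // => /eqP e.
  by rewrite -(nth_index set0 (mE1 x)) e nth_index.
pose rep (c : {set T}) := odflt x0 [pick y in c].
have repP u c : c \in porbits u -> porbit u (rep c) = c.
  case/imsetP => y _ ->; rewrite /rep; case: pickP => [z|/(_ y)].
    by rewrite -eq_porbit_mem => /eqP.
  by rewrite porbit_id.
pose r1 x := rep (porbit s x); pose r2 x := rep (f (porbit s x)).
have r1P x : porbit s (r1 x) = porbit s x by apply/repP/porbit_imset.
have r2P x : porbit t (r2 x) = f (porbit s x) by apply/repP/fP.
have r2card x : #|porbit t (r2 x)| = #|porbit s (r1 x)| by rewrite r2P fcard r1P.
pose ix x := index x (traject s (r1 x) #|porbit s (r1 x)|).
have ixP x : (ix x < #|porbit s (r1 x)|)%N /\ iter (ix x) s (r1 x) = x.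
  have m : x \in traject s (r1 x) #|porbit s (r1 x)|.
    by rewrite -porbit_traject r1P porbit_id.
  have lt : (ix x < #|porbit s (r1 x)|)%N by rewrite -[X in (_ < X)%N](size_traject s (r1 x)) index_mem.
  by split=> //; rewrite -(nth_traject s lt) nth_index.
pose g x := iter (ix x) t (r2 x).
have gP x : porbit t (g x) = f (porbit s x) by rewrite /g -permX porbit_perm r2P.
have ginj : injective g.
  move=> x y e; have c : porbit s x = porbit s y by apply: finj; rewrite -!gP e.
  have [ltx <-] := ixP x; have [lty <-] := ixP y.
  have er1 : r1 x = r1 y by rewrite /r1 c.
  have er2 : r2 x = r2 y by rewrite /r2 c.
  rewrite er1; congr (iter _ _ _).
  apply: (@iter_porbit_inj t (r2 y)); rewrite ?r2card -?er1 //.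
    by rewrite er1.
  by rewrite -{1}er2.
have gs x : g (s x) = t (g x).
  have c : porbit s (s x) = porbit s x by rewrite -[s x]/((s ^+ 1)%g x) porbit_perm.
  have er1 : r1 (s x) = r1 x by rewrite /r1 c.
  have er2 : r2 (s x) = r2 x by rewrite /r2 c.
  have [lt e] := ixP (s x); have [ltx ex] := ixP x.
  rewrite /g er2 -iterS -(iter_porbit_mod t _ (ix x).+1); congr (iter _ _ _).
  apply: (@iter_porbit_inj s (r1 x)); rewrite ?r2card -?er1 ?ltn_mod //.
    by rewrite lt0n card_porbit_neq0.
  by rewrite iter_porbit_mod e er1 iterS ex.
exists (perm ginj); apply/permP => y.
by rewrite -(permKV (perm ginj) y) permJ !permE gs.
Qed.

End Conjugacy.

Lemma mkpart_filter (s : seq nat) : perm_eq (mkpart s) [seq i <- s | (0 < i)%N].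
Proof. by rewrite perm_sort. Qed.

Lemma intpart_gt0 (l : intpart) : all (fun i => 0 < i)%N l.
Proof.
case: l => l /= /andP[_ l0]; apply/allP => i il; rewrite lt0n.
by apply: contraNneq l0 => <-.
Qed.

Lemma mkpart_id (l : intpart) : mkpart l = l.
Proof.
apply: val_inj => /=; rewrite (all_filterP (intpart_gt0 l)).
case: l => l /= /andP[sl _]; apply: sorted_sort => // x y z xy yz.
exact: leq_trans yz xy.
Qed.

Lemma mkpart_perm (s t : seq nat) : perm_eq s t -> mkpart s = mkpart t.
Proof.
move=> st; apply: val_inj => /=; apply/perm_sortP.
- by move=> x y; apply: leq_total.
- by move=> x y z xy yz; apply: leq_trans yz xy.
- by move=> x y /andP[xy yx]; apply/anti_leq/andP; split.
by apply: perm_filter.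
Qed.

Lemma sumn_mkpart (s : seq nat) : sumn (mkpart s) = sumn s.
Proof.
rewrite (perm_sumn (mkpart_filter s)); elim: s => //= i s <-.
by case: i.
Qed.

Lemma mem_partitions (n : nat) (l : intpart) :
  (l \in partitions n) = (sumn l == n).
Proof.
rewrite mem_undup; apply/mapP/eqP => [[t]|ln].
  by rewrite mem_filter => /andP[/eqP tn _] ->; rewrite sumn_mkpart.
have szl : (size l <= n)%N.
  rewrite -ln; elim: (val l) (intpart_gt0 l) => //= i s IHs /andP[i0 /IHs le].
  by rewrite -add1n leq_add.
pose s := [seq inord i : 'I_n.+1 | i <- l ++ nseq (n - size l) 0%N].
have ss : size s == n by rewrite size_map size_cat size_nseq subnKC.
have vs : map val s = l ++ nseq (n - size l) 0%N.
  rewrite -map_comp map_id_in // => i; rewrite mem_cat => ils /=.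
  rewrite inordK // ltnS; case/orP: ils => [il|/nseqP[-> //]].
  rewrite -ln; elim: (val l) il => //= j r IHr; rewrite inE => /predU1P[->|/IHr le].
    exact: leq_addr.
  exact: leq_trans le (leq_addl _ _).
have fs : mkpart (map val s) = l.
  rewrite vs -[RHS]mkpart_id; apply: val_inj => /=; congr (sort _ _).
  by rewrite filter_cat filter_nseq cats0.
exists (Tuple ss) => //=.
by rewrite mem_filter mem_enum andbT -sumn_mkpart fs ln eqxx.
Qed.

Lemma sumn_cycle_type (n : nat) (s : {perm 'I_n}) : sumn (cycle_type s) = n.
Proof.
rewrite sumn_mkpart sumnE big_image /= -[RHS]card_ord -cardsT.
apply/esym/card_partition.
have -> : porbits s = [set orbit (perm_action 'I_n) <[s]> x | x in [set: 'I_n]].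
  by apply/setP => c; apply/imsetP/imsetP => -[x _ ->]; exists x; rewrite ?porbitE ?inE.
by apply: orbit_partition; apply/subsetP => g _; rewrite !inE; apply/subsetP => x; rewrite !inE.
Qed.

Lemma cycle_type_conj (n : nat) (s t : {perm 'I_n}) :
  cycle_type s = cycle_type t -> exists u, t = (s ^ u)%g.
Proof.
have ct (w : {perm 'I_n}) : perm_eq (cycle_type w) [seq #|pred_of_set c| | c in porbits w].
  rewrite (permPl (mkpart_filter _)) (all_filterP _) //.
  apply/allP => _ /imageP[c /imsetP[x _ ->] ->].
  by rewrite lt0n card_porbit_neq0.
move=> st; apply: perm_conj_porbits.
by rewrite -(permPl (ct s)) st (permPl (ct t)).
Qed.

Lemma gcoef_expansion (n : nat) (a : intpart -> int) (s : {perm 'I_n}) :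
  gcoef (\sum_(l <- partitions n) class_sum n l *~ a l) s = a (cycle_type s).
Proof.
have cs l : gcoef (class_sum n l) s = (cycle_type s == l)%:R.
  rewrite gcoef_sum; have [<-|ne] := eqVneq; last first.
    rewrite big1 // => t /eqP tl; rewrite ffunE; case: eqP => // st.
    by move: ne; rewrite st tl eqxx.
  by rewrite (bigD1 s) //= ffunE eqxx big1 ?addr0 // => t /andP[_ /negPf ts]; rewrite ffunE eq_sym ts.
rewrite gcoef_sum (bigD1_seq (cycle_type s)) ?undup_uniq //=; last first.
  by rewrite mem_partitions sumn_cycle_type.
rewrite gcoef_mulz cs eqxx mul1r big1 ?addr0 // => l /negPf ne.
by rewrite gcoef_mulz cs eq_sym ne mul0r.
Qed.

Lemma JM_complete_coeffs_exist : exists a, JM_complete_coeffs a.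
Proof.
pose a k (l : intpart) : int :=
  if [pick s : {perm 'I_(sumn l)} | cycle_type s == l] is Some s
  then gcoef (hsym k (@JM (sumn l))) s else 0.
exists a => n k; apply: val_inj; apply/ffunP => s.
rewrite -[val]/(@gcoef _) gcoef_expansion.
suff aE N (l : intpart) (t : {perm 'I_N}) : sumn l = N -> cycle_type t = l ->
    gcoef (hsym k (@JM N)) t = a k l by apply: aE; rewrite ?sumn_cycle_type.
move=> eN; case: N / eN t => t tl; rewrite /a.
case: pickP => [r /eqP rl|/(_ t)]; last by rewrite tl eqxx.
have [|u ->] := @cycle_type_conj _ t r; first by rewrite tl rl.
by rewrite comm_gcoefJ //; apply/commr_sym/hsym_JM_central.
Qed.

(* Main.v *)
(* Choose a permutation t of cycle type rho + (m) whose m-cycle contains the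
   last point q, and compare the coefficients of t in
     h_k(J_1..J_N) = h_k(J_1..J_(N-1)) + h_(k-1)(J_1..J_N) J_N.
   The first summand lives on the permutations fixing q, which gives the term
   with delta_{m,1}.  The coefficient of t in the second one is the sum over
   y != q of the coefficients of t (y q) in h_(k-1); multiplication by (y q)
   merges the cycle of y with the m-cycle when y lies outside the latter, and
   otherwise splits the m-cycle into two cycles of lengths r and m - r. *)

Require Import Defs.
From mathcomp Require Import all_boot all_order all_fingroup all_algebra.

Set Implicit Arguments.
Unset Strict Implicit.

Import Order.TTheory GRing.Theory Num.Theory.
Local Open Scope ring_scope.

(** * Cycles of the product of a permutation and a transposition *)

Section MulTperm.
Local Open Scope group_scope.
Variable T : finType.
Implicit Types (s : {perm T}) (x y z : T).

(** In [s * tperm x y] the transposition acts after [s], so it only sees the points reached at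
    positive times; [z] itself may be [x] or [y]. *)
Lemma iter_mul_tperm s x y z n :
    (forall i, (0 < i < n)%N -> iter i s z != x) ->
    (forall i, (0 < i < n)%N -> iter i s z != y) ->
  forall i, (i < n)%N -> iter i (s * tperm x y) z = iter i s z.
Proof.
move=> nx ny; elim=> //= i IHi lt_in; rewrite IHi 1?ltnW // permM.
by rewrite tpermD // eq_sym; [apply: (nx i.+1) | apply: (ny i.+1)].
Qed.

Lemma porbit_mul_tpermD s x y z :
    x \notin porbit s z -> y \notin porbit s z ->
  porbit (s * tperm x y) z = porbit s z.
Proof.
move=> nx ny.
have e i : ((s * tperm x y) ^+ i) z = (s ^+ i) z.
  rewrite !permX; apply: (@iter_mul_tperm s x y z i.+1) => // j _.
    by rewrite -permX; apply: contraNneq nx => <-; apply: mem_porbit.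
  by rewrite -permX; apply: contraNneq ny => <-; apply: mem_porbit.
by apply/setP => u; apply/porbitP/porbitP => -[i ->]; exists i.
Qed.

Lemma iter_porbit_neq s x i : (0 < i < #|porbit s x|)%N -> iter i s x != x.
Proof.
case/andP=> i0 lti; apply/eqP => e.
have := @iter_porbit_inj _ s x i 0%N lti; rewrite lt0n card_porbit_neq0 => /(_ isT e).
by move=> i00; rewrite i00 in i0.
Qed.

Lemma iter_mul_tperm_porbit s x y i : y \notin porbit s x ->
  (i < #|porbit s x|)%N -> iter i (s * tperm x y) x = iter i s x.
Proof.
move=> ny; apply: iter_mul_tperm => j; first exact: iter_porbit_neq.
by move=> _; rewrite -permX; apply: contraNneq ny => <-; apply: mem_porbit.
Qed.

(** The walk from [x] follows [s] to the last point of its cycle; there [s] would return to [x], and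
    the transposition diverts it to [y]. *)
Lemma iter_mul_tperm_card s x y : y \notin porbit s x ->
  iter #|porbit s x| (s * tperm x y) x = y.
Proof.
move=> ny; have := iter_porbit s x.
have := @iter_mul_tperm_porbit s x y #|porbit s x|.-1 ny.
case: #|porbit s x| (card_porbit_neq0 s x) => //= n _ -> // e.
by rewrite permM e tpermL.
Qed.

(** The diverted walk links the two cycles and runs through both, while every point outside them
    keeps its cycle. *)
Lemma porbit_mul_tperm s x y : y \notin porbit s x ->
  porbit (s * tperm x y) x = porbit s x :|: porbit s y.
Proof.
move=> ny; have nx : x \notin porbit s y by rewrite porbit_sym.
have oy : porbit (s * tperm x y) y = porbit (s * tperm x y) x.
  by rewrite -{2}(iter_mul_tperm_card ny) -permX porbit_perm.
apply/setP => z; rewrite inE; apply/idP/idP.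
  apply: contraLR; rewrite negb_or ![z \in _]porbit_sym => /andP[zx zy].
  by rewrite porbit_mul_tpermD.
case/orP; rewrite porbit_traject => /trajectP[i lti ->].
  by rewrite -(@iter_mul_tperm_porbit s x y) // -permX mem_porbit.
(* The same argument with [x] and [y] exchanged. *)
by rewrite -oy -(@iter_mul_tperm_porbit s y x) // tpermC -permX mem_porbit.
Qed.

Lemma porbitsD_mul_tperm s x y : y \notin porbit s x ->
  porbits (s * tperm x y) :\ porbit (s * tperm x y) x =
  porbits s :\ porbit s x :\ porbit s y.
Proof.
move=> ny; have oE := porbit_mul_tperm ny.
apply/setP => c; rewrite !inE; apply/idP/idP.
  case/andP=> nc /imsetP[z _ cz]; move: nc; rewrite {c}cz.
  rewrite eq_porbit_mem oE inE negb_or => /andP[zx zy].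
  by rewrite porbit_mul_tpermD 1?porbit_sym // !eq_porbit_mem zx zy imset_f.
case/and3P=> ncy ncx /imsetP[z _ cz]; move: ncx ncy; rewrite {c}cz.
rewrite !eq_porbit_mem => zx zy.
have <- : porbit (s * tperm x y) z = porbit s z.
  by rewrite porbit_mul_tpermD 1?porbit_sym.
by rewrite eq_porbit_mem oE inE (negPf zx) (negPf zy) imset_f.
Qed.

(** The walk from [x] follows [s] until time [r], when the transposition replaces the point
    [iter r s x] by [x]: the cycle closes after [r] steps. *)
Lemma porbit_mul_tperm_iter s x r : (0 < r < #|porbit s x|)%N ->
  porbit (s * tperm (iter r s x) x) x =i traject s x r.
Proof.
case/andP=> r0 ltr; set y := iter r s x; set t := s * _.
have tE i : (i < r)%N -> iter i t x = iter i s x.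
  apply: iter_mul_tperm => j /andP[j0 ltj]; last first.
    by apply: iter_porbit_neq; rewrite j0 (ltn_trans ltj).
  apply/eqP => e; have jr : j = r.
    by apply: iter_porbit_inj e => //; apply: ltn_trans ltj ltr.
  by rewrite jr ltnn in ltj.
have tr : iter r t x = x.
  move: tE ltr; rewrite /t /y; case: r r0 {t y} => //= r _ -> // _.
  by rewrite permM tpermL.
have tM i : iter i t x = iter (i %% r) t x.
  rewrite {1}(divn_eq i r) addnC iterD; congr (iter _ _ _).
  by elim: (i %/ r)%N => [|d IHd]; rewrite ?mul0n // mulSn addnC iterD tr.
move=> z; apply/idP/idP => [/porbitP[i ->]|/trajectP[i lti ->]].
  by rewrite permX tM tE ?ltn_mod //; apply/trajectP; exists (i %% r)%N; rewrite ?ltn_mod.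
by rewrite -tE // -permX mem_porbit.
Qed.

Lemma iter_porbit_split s x r : (0 < r < #|porbit s x|)%N ->
  iter r s x \notin porbit (s * tperm (iter r s x) x) x.
Proof.
move=> rb; rewrite porbit_mul_tperm_iter //; case/andP: rb => _ ltr.
apply/trajectP => -[i lti e]; have ir : r = i.
  by apply: iter_porbit_inj e => //; apply: ltn_trans lti ltr.
by rewrite ir ltnn in lti.
Qed.

Lemma card_porbit_split s x r : (0 < r < #|porbit s x|)%N ->
  #|porbit (s * tperm (iter r s x) x) x| = r.
Proof.
move=> rb; rewrite (eq_card (porbit_mul_tperm_iter rb)).
rewrite -[RHS](size_traject s x); apply/card_uniqP.
have := uniq_traject_porbit s x; have /andP[_ /ltnW/subnKC <-] := rb.
by rewrite trajectD cat_uniq => /andP[].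
Qed.

(** The list inside [cycle_type], before [mkpart]. It is compared up to [perm_eq], which avoids
    sorting. *)
Definition cycle_lengths s := [seq #|pred_of_set c| | c in porbits s].

Definition other_cycle_lengths s x :=
  [seq #|pred_of_set c| | c in porbits s :\ porbit s x].

Lemma perm_enum_setD1 (U : finType) (A : {set U}) c : c \in A ->
  perm_eq (enum A) (c :: enum (A :\ c)).
Proof.
move=> Ac; apply: uniq_perm; rewrite /= ?mem_enum ?setD11 ?enum_uniq // => d.
by rewrite inE !mem_enum !inE; case: eqVneq => // ->.
Qed.

Lemma cycle_lengthsD s x :
  perm_eq (cycle_lengths s) (#|porbit s x| :: other_cycle_lengths s x).
Proof. exact: perm_map (perm_enum_setD1 (porbit_imset s x)). Qed.

Lemma card_porbit_merge s x y : y \notin porbit s x ->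
  #|porbit (s * tperm x y) x| = (#|porbit s x| + #|porbit s y|)%N.
Proof.
move=> ny; rewrite porbit_mul_tperm // cardsU.
suff -> : porbit s x :&: porbit s y = set0 by rewrite cards0 subn0.
apply/setP => z; rewrite !inE; apply/negP => /andP[].
rewrite -!eq_porbit_mem => /eqP -> /eqP xy.
by rewrite xy porbit_id in ny.
Qed.

Lemma other_cycle_lengths_merge s x y : y \notin porbit s x ->
  perm_eq (other_cycle_lengths s x)
          (#|porbit s y| :: other_cycle_lengths (s * tperm x y) x).
Proof.
move=> ny; rewrite /other_cycle_lengths porbitsD_mul_tperm //.
apply: (perm_map _ (perm_enum_setD1 _)).
by rewrite !inE eq_porbit_mem ny porbit_imset.
Qed.

(** The form with [rem] matches the partition obtained from rho by replacing a part p with p + m. *)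
Lemma cycle_lengths_merge s x y : y \notin porbit s x ->
  perm_eq (cycle_lengths (s * tperm y x))
    ((#|porbit s y| + #|porbit s x|)%N ::
     rem #|porbit s y| (other_cycle_lengths s x)).
Proof.
move=> ny; rewrite tpermC; apply: perm_trans (cycle_lengthsD _ x) _.
rewrite card_porbit_merge // addnC perm_cons perm_sym.
rewrite -(perm_cons #|porbit s y|) -(permPr (other_cycle_lengths_merge ny)).
rewrite perm_sym; apply: perm_to_rem.
by rewrite (perm_mem (other_cycle_lengths_merge ny)) mem_head.
Qed.

(** Splitting is merging read backwards: the product has [x] and [iter r s x] in distinct cycles,
    and multiplying it by the same transposition gives back [s]. *)
Lemma cycle_lengths_split s x r : (0 < r < #|porbit s x|)%N ->
  perm_eq (cycle_lengths (s * tperm (iter r s x) x))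
    [:: r, (#|porbit s x| - r)%N & other_cycle_lengths s x].
Proof.
move=> rb; have ny := iter_porbit_split rb; have rE := card_porbit_split rb.
have := card_porbit_merge ny; have := other_cycle_lengths_merge ny.
rewrite (tpermC x) -mulgA tperm2 mulg1 rE => oE ->; rewrite addKn.
by rewrite (permPl (cycle_lengthsD _ x)) rE perm_cons.
Qed.
End MulTperm.

(** * Permutations extended by a fixed point *)

Section LiftPerm.
Local Open Scope group_scope.
Variable n : nat.
Implicit Types (s : {perm 'I_n}) (i : 'I_n.+1).

Lemma tperm_lift i (x y : 'I_n) :
  lift_perm i i (tperm x y) = tperm (lift i x) (lift i y).
Proof.
apply/permP => z; case: (unliftP i z) => [z'|] ->.
  by rewrite lift_perm_lift inj_tperm //; apply: lift_inj.
by rewrite lift_perm_id tpermD // eq_sym neq_lift.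
Qed.

Lemma lift_perm_fix i (t : {perm 'I_n.+1}) : t i = i ->
  exists s, t = lift_perm i i s.
Proof.
move=> ti.
(* As [t] is injective and fixes [i], it never sends [lift i x] to [i], so the default [x] is never
   returned. *)
have tl x : lift i (odflt x (unlift i (t (lift i x)))) = t (lift i x).
  case: unliftP => //= e; case/eqP: (neq_lift i x).
  by apply: (@perm_inj _ t); rewrite ti e.
have inj : injective (fun x => odflt x (unlift i (t (lift i x)))).
  by move=> x y e; apply/(@lift_inj _ i)/(@perm_inj _ t); rewrite -(tl x) -(tl y) e.
exists (perm inj); apply/permP => z; case: (unliftP i z) => [z'|] ->.
  by rewrite lift_perm_lift permE tl.
by rewrite lift_perm_id.
Qed.

Lemma porbit_lift_perm i s (x : 'I_n) :
  porbit (lift_perm i i s) (lift i x) = lift i @: porbit s x.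
Proof.
have e r : (lift_perm i i s ^+ r) (lift i x) = lift i ((s ^+ r) x).
  by rewrite !permX; elim: r => //= r ->; rewrite lift_perm_lift.
apply/setP => z; apply/porbitP/imsetP => [[r ->]|[_ /porbitP[r ->] ->]].
  by exists ((s ^+ r) x); rewrite ?mem_porbit.
by exists r.
Qed.

Lemma card_porbit_lift_perm i s (x : 'I_n) :
  #|porbit (lift_perm i i s) (lift i x)| = #|porbit s x|.
Proof. by rewrite porbit_lift_perm card_imset //; apply: lift_inj. Qed.

Lemma porbit_lift_perm_fix i s : porbit (lift_perm i i s) i = [set i].
Proof.
apply/setP => z; rewrite inE; apply/porbitP/eqP => [[r ->]|->]; last by exists 0%N; rewrite perm1.
by rewrite permX; elim: r => //= r ->; rewrite lift_perm_id.
Qed.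

(** Apart from the fixed point [i], the cycles of the extension are the images under the injection
    [lift i] of those of [s]. *)
Lemma other_cycle_lengths_lift_perm i s :
  perm_eq (other_cycle_lengths (lift_perm i i s) i) (cycle_lengths s).
Proof.
have cl (c : {set 'I_n}) : #|lift i @: c| = #|c|.
  by rewrite card_imset //; apply: lift_inj.
have -> : cycle_lengths s =
    [seq #|pred_of_set c| | c <- [seq lift i @: (c : {set 'I_n}) | c <- enum (porbits s)]].
  by rewrite -map_comp; apply: eq_map => c; rewrite /= cl.
apply: perm_map; apply: uniq_perm; first exact: enum_uniq.
  by rewrite map_inj_uniq ?enum_uniq //; apply/imset_inj/lift_inj.
move=> c; rewrite mem_enum !inE porbit_lift_perm_fix; apply/idP/mapP.
  case/andP=> nc /imsetP[z _ cz]; move: nc; rewrite {c}cz.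
  case: (unliftP i z) => [x|] ->; last by rewrite porbit_lift_perm_fix eqxx.
  by exists (porbit s x); rewrite ?porbit_lift_perm // mem_enum porbit_imset.
case=> d; rewrite mem_enum => /imsetP[x _ ->] ->.
rewrite -porbit_lift_perm porbit_imset andbT -(porbit_lift_perm_fix i s).
by rewrite eq_porbit_mem porbit_lift_perm_fix inE eq_sym neq_lift.
Qed.
End LiftPerm.

(** * Permutations with prescribed cycle lengths *)

(** The cycle grows one point at a time: a new last point is added as a fixed point, then merged
    with the cycle of the former last point. *)
Lemma exists_perm_add_cycle (m n : nat) (s : {perm 'I_n}) :
  exists t : {perm 'I_(m + n).+1}, #|porbit t ord_max| = m.+1 /\
    perm_eq (other_cycle_lengths t ord_max) (cycle_lengths s).
Proof.
elim: m => [|m [t [tm ts]]].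
  exists (lift_perm ord_max ord_max s); rewrite porbit_lift_perm_fix cards1.
  by split=> //; apply: other_cycle_lengths_lift_perm.
set l := lift_perm ord_max ord_max t; set y := lift ord_max (ord_max : 'I_(m + n).+1).
have ny : y \notin porbit l ord_max.
  by rewrite porbit_lift_perm_fix inE eq_sym neq_lift.
have ly : #|porbit l y| = m.+1 by rewrite card_porbit_lift_perm.
exists (l * tperm ord_max y)%g; rewrite card_porbit_merge // ly.
rewrite porbit_lift_perm_fix cards1; split=> //.
(* Adding the length [m.+1] of the absorbed cycle to both sides turns the claim into one about all
   cycles of [t]. *)
rewrite -(perm_cons m.+1) -{1}ly -(permPl (other_cycle_lengths_merge ny)).
rewrite (permPl (other_cycle_lengths_lift_perm _ _)).
by rewrite (permPl (cycle_lengthsD t ord_max)) tm perm_cons.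
Qed.

(** One cycle is added per part; [(m + sumn l).+1] is convertible to [sumn (m.+1 :: l)], so no cast
    arises. *)
Lemma exists_perm_cycle_lengths (l : seq nat) : all (fun i => 0 < i)%N l ->
  exists s : {perm 'I_(sumn l)}, perm_eq (cycle_lengths s) l.
Proof.
elim: l => [_|[//|m] l IHl /= /IHl[s sl]].
  exists 1%g; rewrite /cycle_lengths /image_mem.
  have -> : porbits (1 : {perm 'I_0})%g = set0.
    by apply/setP => c; rewrite inE; apply/imsetP => -[[]].
  by rewrite enum_set0.
have [t [tm ts]] := exists_perm_add_cycle m s; exists t.
by rewrite (permPl (cycle_lengthsD t ord_max)) tm perm_cons (permPl ts).
Qed.

(** * Compatibility of Jucys-Murphy elements with the embedding of group algebras *)

Section Embedding.
Variable n : nat.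
Local Notation L := (lift_perm (@ord_max n) ord_max).

(* [g] is the image of [f] under the ring embedding Z[S_n] -> Z[S_(n+1)]. *)
Definition extends_galg (f : galg {perm 'I_n}) (g : galg {perm 'I_n.+1}) :=
  (forall s, gcoef g (L s) = gcoef f s) /\
  (forall t : {perm 'I_n.+1}, t ord_max != ord_max -> gcoef g t = 0).

Lemma extends_galg0 : extends_galg 0 0.
Proof. by split=> *; rewrite !ffunE. Qed.

Lemma extends_galg1 : extends_galg 1 1.
Proof.
split=> [s|t tq]; rewrite !ffunE.
  congr (nat_of_bool _)%:R; apply/eqP/eqP => [e|->]; last exact: lift_perm1.
  apply/permP => i; apply: (@lift_inj _ ord_max).
  by rewrite -(lift_perm_lift ord_max) e !perm1.
by case: (t =P 1%g) tq => // ->; rewrite perm1 eqxx.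
Qed.

Lemma extends_galgD f f' g g' :
  extends_galg f g -> extends_galg f' g' -> extends_galg (f + f') (g + g').
Proof.
move=> [e z] [e' z']; split=> [s|t tq]; rewrite !ffunE ?e ?e' //.
by rewrite z // z'.
Qed.

Lemma extends_galgMbase f g s :
  extends_galg f g -> extends_galg (f * gbase s) (g * gbase (L s)).
Proof.
move=> [e z]; split=> [t|t tq]; rewrite !gcoef_Mbase.
  by rewrite lift_permV lift_permM e.
rewrite z // permM; apply: contraNneq tq => tq.
by apply/eqP/(@perm_inj _ (L s)^-1%g); rewrite tq lift_permV lift_perm_id.
Qed.

(** Only transpositions fixing the last point occur in this element. Since [i < n], [insubd j i] is
    the ordinal [i], never the default [j]. *)
Lemma JMn_lift (i : nat) : (i < n)%N ->
  JMn n.+1 i = \sum_(j < n | (j < i)%N) gbase (L (tperm j (insubd j i))).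
Proof.
move=> lt_in; pose oi := Ordinal lt_in.
rewrite -[i]/(val (Ordinal (ltnW lt_in : (i < n.+1)%N))) JMnE /JM.
rewrite big_mkcond big_ord_recr /= ltnNge ltnW //= addr0 -big_mkcond /=.
apply: eq_bigr => j _; rewrite tperm_lift; congr (gbase (tperm _ _)).
  by apply: val_inj; rewrite /= /bump leqNgt ltn_ord.
by apply: val_inj; rewrite /= val_insubd lt_in /bump leqNgt lt_in.
Qed.

Lemma extends_galgMJM f g i : (i < n)%N ->
  extends_galg f g -> extends_galg (f * JMn n i) (g * JMn n.+1 i).
Proof.
move=> lt_in fg; rewrite JMn_lift //.
rewrite -[i in JMn n i]/(val (Ordinal lt_in)) JMnE /JM !mulr_sumr.
elim/big_rec2: _ => [|j x y lt_ji xy]; first exact: extends_galg0.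
apply: extends_galgD => //.
have -> : insubd j i = Ordinal lt_in by apply: val_inj; rewrite val_insubd lt_in.
exact: extends_galgMbase.
Qed.

(** With [i = n] this computes all coefficients of the summand of h_k that omits the last
    Jucys-Murphy element. *)
Lemma extends_galg_hrec i k : (i <= n)%N ->
  extends_galg (hrec (JMn n) i k) (hrec (JMn n.+1) i k).
Proof.
elim: i k => [|i IHi] k le_in.
  by rewrite /=; case: k => [|k]; [apply: extends_galg1 | apply: extends_galg0].
elim: k => [|k IHk]; first exact: extends_galg1.
rewrite !hrecSS; apply: extends_galgD; first exact/IHi/ltnW.
exact: extends_galgMJM.
Qed.
End Embedding.

(** * Sums over the points inside and outside a cycle *)

Section PorbitSums.
Variables (T : finType) (s : {perm T}) (x : T).

(** Indexing a point by its distance [r] from [x] along the cycle produces the index of the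
    splitting sum. *)
Lemma sum_porbitD1 (V : nmodType) (F : T -> V) :
  \sum_(y | (y != x) && (y \in porbit s x)) F y =
  \sum_(1 <= r < #|porbit s x|) F (iter r s x).
Proof.
have := uniq_traject_porbit s x; have := porbit_traject s x.
case: #|porbit s x| (card_porbit_neq0 s x) => //= m _ oE /andP[nx ut].
rewrite big_add1 /=; transitivity (\sum_(y <- traject s (s x) m) F y).
  rewrite big_uniq //; apply: eq_bigl => y; rewrite oE inE.
  by case: eqVneq => //= ->; rewrite (negPf nx).
rewrite (big_nth (s x)) size_traject; apply: eq_big_nat => r /andP[_ ltr].
by rewrite nth_traject // -iterSr.
Qed.

(** The points of a cycle of length [p] give [p] equal terms; this is the source of the factor
    rho_i. *)
Lemma sum_other_porbits (V : nmodType) (G : nat -> V) :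
  \sum_(y | y \notin porbit s x) G #|porbit s y| =
  \sum_(p <- other_cycle_lengths s x) G p *+ p.
Proof.
rewrite big_map big_enum /=.
rewrite (partition_big (porbit s) (mem (porbits s :\ porbit s x))) /=; last first.
  by move=> y yx; rewrite !inE eq_porbit_mem yx porbit_imset.
apply: eq_bigr => c; rewrite !inE => /andP[+ /imsetP[z _ cz]].
rewrite {c}cz eq_porbit_mem => zx.
transitivity (\sum_(y in porbit s z) G #|porbit s z|); last by rewrite sumr_const.
apply: eq_big => [y|y /andP[_ /eqP -> //]].
rewrite eq_porbit_mem; case yz: (y \in porbit s z); rewrite ?andbF // andbT.
by move: yz; rewrite -!eq_porbit_mem => /eqP ->; rewrite eq_porbit_mem.
Qed.
End PorbitSums.

(** * Coefficients of h_k and the recurrence *)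

Lemma gcoef_hrec (a : nat -> intpart -> int) (n k : nat) (s : {perm 'I_n}) :
  JM_complete_coeffs a ->
  gcoef (hrec (JMn n) n k) s = a k (mkpart (cycle_lengths s)).
Proof. by move=> Ha; rewrite -hsym_JM Ha gcoef_expansion. Qed.

Lemma gcoefMJM (n : nat) (f : galg {perm 'I_n.+1}) (s : {perm 'I_n.+1}) :
  gcoef (f * JMn n.+1 n) s =
  \sum_(y | y != ord_max) gcoef f (s * tperm y ord_max)%g.
Proof.
rewrite -[n in JMn _ n]/(val (@ord_max n)) JMnE /JM mulr_sumr gcoef_sum.
apply: eq_big => [y|y _]; last by rewrite gcoef_Mbase tpermV.
by rewrite ltn_neqAle -ltnS ltn_ord andbT.
Qed.

Theorem theorem2p6 (a : nat -> intpart -> int) (Ha : JM_complete_coeffs a)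
    (rho : intpart) (k m : nat) (k_gt0 : (0 < k)%N) (m_gt0 : (0 < m)%N) :
  a k (mkpart (m :: rho)) =
    (m == 1%N)%:R * a k rho
    + \sum_(i < size rho)
        (nth 0%N rho i)%:R
        * a k.-1 (mkpart ((nth 0 rho i + m)%N :: rem (nth 0%N rho i) rho))
    + \sum_(1 <= r < m) \sum_(1 <= s < m | (r + s == m)%N)
        a k.-1 (mkpart [:: r, s & rho]).
Proof.
(* From here on [k] and [m] are the predecessors of the original integers, so the chosen cycle has
   length [m.+1]. *)
case: k k_gt0 => // k _; case: m m_gt0 => // m _ /=.
have [s0 s0E] := exists_perm_cycle_lengths (intpart_gt0 rho).
have [t [tm]] := exists_perm_add_cycle m s0.
move: t tm; set n := (m + sumn rho)%N; set q := ord_max => t tm tE.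
have {s0 s0E tE}tE : perm_eq (other_cycle_lengths t q) rho.
  exact: perm_trans tE s0E.
have tT : perm_eq (cycle_lengths t) (m.+1 :: rho).
  by rewrite (permPl (cycle_lengthsD t q)) tm perm_cons.
rewrite -(mkpart_perm tT) -(gcoef_hrec k.+1 t Ha) // hrecSS ffunE -addrA.
congr (_ + _).
  have [fixE mvE] := extends_galg_hrec (n := n) k.+1 (leqnn n).
  (* If [m = 0], then [t] fixes [q] and restricts to a permutation of type [rho]; otherwise [t]
     moves [q] and the coefficient vanishes. *)
  have [m0|m0] := eqVneq m 0%N.
    have tq : t q = q by have := iter_porbit t q; rewrite tm m0.
    have [s ts] := lift_perm_fix tq; rewrite {}ts in tE *.
    rewrite fixE (gcoef_hrec _ _ Ha) m0 mul1r; congr (a _ _).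
    rewrite -[RHS]mkpart_id; apply: mkpart_perm.
    by rewrite -(permPl (other_cycle_lengths_lift_perm q s)).
  rewrite eqSS (negPf m0) mul0r mvE // -[t _]/(iter 1 t q).
  by apply: iter_porbit_neq; rewrite tm /= ltnS lt0n.
rewrite gcoefMJM (bigID (fun y => y \in porbit t q)) /= addrC.
congr (_ + _).
  pose G p := a k (mkpart ((p + m.+1)%N :: rem p rho)).
  transitivity (\sum_(y | y \notin porbit t q) G #|porbit t y|).
    apply: eq_big => [y|y /andP[_ ny]].
      by case: eqVneq => // ->; rewrite porbit_id.
    rewrite (gcoef_hrec _ _ Ha) /G; congr (a _ _); apply: mkpart_perm.
    apply: perm_trans (cycle_lengths_merge ny) _; rewrite tm perm_cons.
    (* Counting entries shows that [rem] respects [perm_eq]. *)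
    by apply/seq.permP => p; rewrite !count_rem (perm_mem tE) (seq.permP tE).
  rewrite sum_other_porbits (perm_big _ tE) (big_nth 0%N) big_mkord.
  by apply: eq_bigr => i _; rewrite mulr_natl.
rewrite sum_porbitD1 tm; apply: eq_big_nat => r /andP[r0 ltr].
have -> : \sum_(1 <= s < m.+1 | (r + s == m.+1)%N) a k (mkpart [:: r, s & rho])
    = a k (mkpart [:: r, (m.+1 - r)%N & rho]).
  (* For fixed [r] the only term is [s = m.+1 - r], which lies in the range because
     [0 < r < m.+1]. *)
  rewrite (eq_bigl (fun s => s == (m.+1 - r)%N)) => [|s]; last first.
    by rewrite -[RHS](eqn_add2l r) subnKC // ltnW.
  by rewrite big_nat1_eq subn_gt0 ltr ltn_subrL r0.
rewrite (gcoef_hrec _ _ Ha); congr (a _ _); apply: mkpart_perm.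
have rb : (0 < r < #|porbit t q|)%N by rewrite tm r0.
by rewrite (permPl (cycle_lengths_split rb)) tm !perm_cons.
Qed.
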